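(* Let $n,l\ge 1$ be integers such that $nl$ is even. Then the knot semigroup $M(\mathfrak{dtw}_n^l)$ of the double twist knot diagram $\mathfrak{dtw}_n^l$ is isomorphic, as a semigroup, to the alternating sum semigroup $$\mathrm{AS}\bigl(\mathbb{Z}_{ln+1},\{0,1,\dots,n,\;0\cdot n+1,\;1\cdot n+1,\;\dots,\;(l-1)\cdot n+1\}\bigr).$$
   Context: **Knot semigroup.** A semigroup $S$ is cancellative if for all $x,y,z\in S$, $xz=yz$ implies $x=y$ and $xy=xz$ implies $y=z$. An arc of a knot diagram is a continuous line on the diagram from one undercrossing to another undercrossing. The knot semigroup $M(K)$ of a diagram $K$ is the cancellative semigroup generated by the arcs of $K$ with, for every crossing where $y$ is the overcrossing arc and $x,z$ are the two arcs forming the undercrossing, the two defining relations $xy=yz$ and $yx=zy$. That is, $M(K)=A^+/\kappa$, where $A$ is the set of arcs, $A^+$ is the free semigroup (nonempty words) on $A$, and $\kappa$ is the smallest congruence on $A^+$ that contains the defining relations and has cancellative quotient. **Double twist knot diagram.** $\mathfrak{dtw}_n^l$ is the standard diagram of the double twist knot, i.e. the 2-bridge knot with Conway normal form $C(l,n)$, consisting of $n$ clockwise half-twists ($n$ crossings) and $l$ anticlockwise half-twists ($l$ crossings). Its arcs are $$A=\{a_0,a_1,\dots,a_n,a_{n+1},a_{2n+1},\dots,a_{(l-1)n+1}\},$$ with indices read modulo $ln+1$ (so $a_{ln+1}=a_0$ and $a_{(l+1)n+1}=a_n$), and the defining relations of $M(\mathfrak{dtw}_n^l)$ are: - $a_{i-1}a_i=a_ia_{i+1}$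 and $a_ia_{i-1}=a_{i+1}a_i$ for $i=1,\dots,n$; - $a_{(l-j-1)n+1}a_{(l-j)n+1}=a_{(l-j)n+1}a_{(l-j+1)n+1}$ and $a_{(l-j)n+1}a_{(l-j-1)n+1}=a_{(l-j+1)n+1}a_{(l-j)n+1}$ for $j=0,1,\dots,l-1$. **Alternating sum semigroup.** Let $G$ be $\mathbb{Z}$ or $\mathbb{Z}_N$, let $B\subseteq G$, and let $B^+$ be the set of nonempty words over $B$. For a word $b_1\cdots b_k\in B^+$, let $|b_1\cdots b_k|=k$ and $\mathrm{alt}(b_1\cdots b_k)=b_1-b_2+b_3-\dots+(-1)^{k+1}b_k$, computed in $G$. Write $u\sim v$ if $|u|=|v|$ and $\mathrm{alt}(u)=\mathrm{alt}(v)$; this is a congruence on $B^+$, and $\mathrm{AS}(G,B)=B^+/\sim$. Integers are regarded as elements of $\mathbb{Z}_N$ by reduction modulo $N$. *)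

(* Defs.v *)
From HB Require Import structures.
From mathcomp Require Import all_boot all_order all_algebra.
From mathcomp Require Import boolp.

Set Implicit Arguments.
Unset Strict Implicit.
Unset Printing Implicit Defensive.

Import GRing.Theory.

Definition sgrp_isomorphic (S T : semigroupType) : Prop :=
  exists f : {multiplicative S -> T}, bijective f.

Definition cancellative (S : semigroupType) : Prop :=
  (forall x y z : S, (x * z)%g = (y * z)%g -> x = y) /\
  (forall x y z : S, (x * y)%g = (x * z)%g -> y = z).

Record congruence (S : semigroupType) := Congruence {
  cong_equiv :> equiv_rel S;
  congM : forall x x' y y' : S,
    cong_equiv x x' -> cong_equiv y y' -> cong_equiv (x * y)%g (x' * y')%g }.

Definition quot_sgrp (S : semigroupType) (c : congruence S) : Type :=
  {eq_quot c}%qT.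

Section QuotientSemigroup.
Local Open Scope quotient_scope.

Variables (S : semigroupType) (c : congruence S).

HB.instance Definition _ := Choice.on (quot_sgrp c).
HB.instance Definition _ := EqQuotient.on (quot_sgrp c).

Definition quot_mul (p q : quot_sgrp c) : quot_sgrp c :=
  \pi_(quot_sgrp c) (repr p * repr q)%g.

Lemma quot_mul_pi (x y : S) :
  quot_mul (\pi_(quot_sgrp c) x) (\pi_(quot_sgrp c) y) =
  \pi_(quot_sgrp c) (x * y)%g.
Proof. by apply/eqmodP/congM; apply/eqmodP; rewrite reprK. Qed.

Lemma quot_mulA : associative quot_mul.
Proof.
move=> p q r; elim/quotW: p => x; elim/quotW: q => y; elim/quotW: r => z.
by rewrite (quot_mul_pi y z) (quot_mul_pi x y) !quot_mul_pi mulgA.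
Qed.

HB.instance Definition _ := isSemigroup.Build (quot_sgrp c) quot_mulA.

Lemma pi_mulg (x y : S) :
  (\pi_(quot_sgrp c) x * \pi_(quot_sgrp c) y)%g = \pi_(quot_sgrp c) (x * y)%g.
Proof. exact: quot_mul_pi. Qed.

End QuotientSemigroup.

Definition free_sgrp (A : Type) : Type := {w : seq A | ~~ nilp w}.

Section FreeSemigroup.
Variable A : choiceType.

HB.instance Definition _ := Choice.on (free_sgrp A).

Lemma cat_nonempty (u v : free_sgrp A) : ~~ nilp (val u ++ val v).
Proof. by case: u => [[|a u] nu]. Qed.

Definition free_mul (u v : free_sgrp A) : free_sgrp A :=
  exist _ (val u ++ val v) (cat_nonempty u v).

Lemma free_mulA : associative free_mul.
Proof. by move=> u v w; apply: val_inj; rewrite /= catA. Qed.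

HB.instance Definition _ := isSemigroup.Build (free_sgrp A) free_mulA.

Definition letter (a : A) : free_sgrp A := exist _ [:: a] isT.

End FreeSemigroup.

(* The combinatorial data of a diagram: in a crossing (x, y, z), the arc y    *)
(* passes over and x, z are the two arcs of the undercrossing. The relations  *)
(* below do not depend on the order of x and z.                               *)
Record diagram := Diagram {
  diagram_arc : finType;
  crossings : seq (diagram_arc * diagram_arc * diagram_arc) }.

Section KnotSemigroup.
Variable K : diagram.

Definition respects_crossings (c : congruence (free_sgrp (diagram_arc K))) :
    Prop :=
  forall x y z : diagram_arc K, (x, y, z) \in crossings K ->
    c (letter x * letter y)%g (letter y * letter z)%g /\
    c (letter y * letter x)%g (letter z * letter y)%g.

Definition admissible (c : congruence (free_sgrp (diagram_arc K))) : Prop :=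
  respects_crossings c /\ cancellative (quot_sgrp c).

(* The intersection of all admissible congruences, which is itself admissible *)
(* ([kappa_admissible]), hence the smallest one.                              *)
Definition kappa_rel : rel (free_sgrp (diagram_arc K)) := fun u v =>
  `[< forall c : congruence (free_sgrp (diagram_arc K)),
        admissible c -> c u v >].

Lemma kappa_refl : reflexive kappa_rel.
Proof. by move=> u; apply/asboolP => c _; apply: equiv_refl. Qed.

Lemma kappa_sym : symmetric kappa_rel.
Proof.
move=> u v; apply/asboolP/asboolP => H c /H;
  by rewrite equiv_sym.
Qed.

Lemma kappa_trans : transitive kappa_rel.
Proof.
move=> v u w /asboolP uv /asboolP vw; apply/asboolP => c Hc.
exact: equiv_trans (uv c Hc) (vw c Hc).
Qed.

Definition kappa_equiv := EquivRel kappa_rel kappa_refl kappa_sym kappa_trans.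

Lemma kappaM (u u' v v' : free_sgrp (diagram_arc K)) :
  kappa_equiv u u' -> kappa_equiv v v' ->
  kappa_equiv (u * v)%g (u' * v')%g.
Proof.
move=> /asboolP uu' /asboolP vv'; apply/asboolP => c Hc.
exact: congM (uu' c Hc) (vv' c Hc).
Qed.

Definition kappa : congruence (free_sgrp (diagram_arc K)) := Congruence kappaM.

Lemma kappa_min (c : congruence (free_sgrp (diagram_arc K))) u v :
  admissible c -> kappa u v -> c u v.
Proof. by move=> Hc /asboolP; apply. Qed.

Lemma kappa_admissible : admissible kappa.
Proof.
split=> [x y z xyz|].
  by split; apply/asboolP => c [cr _]; case: (cr _ _ _ xyz).
split; move=> p q r; elim/quotW: p => x; elim/quotW: q => y; elim/quotW: r => z;
  rewrite !pi_mulg => /eqmodP/asboolP E; apply/eqmodP/asboolP => c Hc;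
  have /eqmodP := E c Hc; rewrite -!pi_mulg; case: (Hc) => _ [cr cl].
- by move/cr/eqmodP.
- by move/cl/eqmodP.
Qed.

Definition knot_sgrp : semigroupType := quot_sgrp kappa.

End KnotSemigroup.

(* The integers modulo N + 1 are represented by the [zmodType] 'I_N.+1; the   *)
(* class of k is [inZp k]. Unlike 'Z_N.+1, this is correct for all N.         *)

Section DoubleTwist.
Variables n l : nat.

Definition dtw_index : {set 'I_(l * n).+1} :=
  [set inZp (val i) | i : 'I_n.+1] :|:
  [set inZp (val j * n + 1) | j : 'I_l & 0 < val j].

Definition dtw_arc : finType := {x : 'I_(l * n).+1 | x \in dtw_index}.

Lemma inZp0_dtw : inZp 0 \in dtw_index.
Proof. by rewrite inE; apply/orP; left; apply/imsetP; exists ord0. Qed.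

(* The arc a_k. The default value a_0 of [insubd] is never used for the       *)
(* indices occurring in [dtw]: see [val_dtw_a] and [val_dtw_a_mul].           *)
Definition dtw_a (k : nat) : dtw_arc :=
  insubd (exist _ (inZp 0) inZp0_dtw : dtw_arc) (inZp k).

Definition dtw : diagram := @Diagram dtw_arc
  ([seq (dtw_a i.-1, dtw_a i, dtw_a i.+1) | i <- iota 1 n] ++
   [seq (dtw_a ((l - j - 1) * n + 1), dtw_a ((l - j) * n + 1),
         dtw_a ((l - j + 1) * n + 1)) | j <- iota 0 l]).

Lemma inZp_dtw i : i <= n -> inZp i \in dtw_index.
Proof.
move=> le_in; rewrite inE; apply/orP; left; apply/imsetP.
by exists (Ordinal (le_in : i < n.+1)).
Qed.

Lemma inZp_mul_dtw j : j <= l.+1 -> inZp (j * n + 1) \in dtw_index.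
Proof.
have eqZp a b : a = b %[mod (l * n).+1] -> inZp a = inZp b :> 'I_(l * n).+1.
  by move=> ab; apply: val_inj.
case: (ltngtP j l) => [jl _|lj jl1|-> _].
- case: (posnP j) => [->|j0].
    case: (posnP n) => [n0|n0]; last exact: inZp_dtw.
    rewrite (_ : inZp _ = inZp 0); first exact: inZp_dtw.
    by apply: eqZp; rewrite n0 !muln0 !modn1.
  rewrite inE; apply/orP; right; apply/imsetP.
  by exists (Ordinal jl); rewrite ?inE.
- have -> : j = l.+1 by apply/eqP; rewrite eqn_leq jl1 lj.
  rewrite (_ : inZp _ = inZp n); first exact: inZp_dtw.
  by apply: eqZp; rewrite mulSn -addnA addn1 modnDr.
- rewrite (_ : inZp _ = inZp 0); first exact: inZp_dtw.
  by apply: eqZp; rewrite addn1 modnn mod0n.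
Qed.

Lemma val_dtw_a i : i <= n.+1 -> val (dtw_a i) = inZp i.
Proof.
rewrite leq_eqVlt => /predU1P[->|lt_in]; rewrite val_insubd.
  have -> : n.+1 = 1 * n + 1 by rewrite mul1n addn1.
  by rewrite inZp_mul_dtw.
by rewrite inZp_dtw.
Qed.

Lemma val_dtw_a_mul j :
  j <= l.+1 -> val (dtw_a (j * n + 1)) = inZp (j * n + 1).
Proof. by move=> lj; rewrite val_insubd inZp_mul_dtw. Qed.

End DoubleTwist.

Section AlternatingSum.
Local Open Scope ring_scope.

Definition alt (G : zmodType) (w : seq G) : G :=
  \sum_(i < size w) w`_i *~ (-1) ^+ i.

Lemma alt_cat (G : zmodType) (u v : seq G) :
  alt (u ++ v) = alt u + alt v *~ (-1) ^+ size u.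
Proof.
rewrite /alt size_cat big_split_ord /=; congr (_ + _).
  by apply: eq_bigr => i _; rewrite nth_cat ltn_ord.
rewrite mulrz_suml; apply: eq_bigr => i _.
by rewrite nth_cat ltnNge leq_addr addKn exprD mulrC mulrzA.
Qed.

Variables (G : zmodType) (B : {pred G}).

Definition subset_letter : choiceType := {b : G | b \in B}.

Definition word_val (w : free_sgrp subset_letter) : seq G := map val (val w).

Definition as_rel : rel (free_sgrp subset_letter) := fun u v =>
  (size (val u) == size (val v)) && (alt (word_val u) == alt (word_val v)).

Lemma as_refl : reflexive as_rel.
Proof. by move=> u; rewrite /as_rel !eqxx. Qed.

Lemma as_sym : symmetric as_rel.
Proof.
by move=> u v; rewrite /as_rel eq_sym; congr (_ && _); rewrite eq_sym.
Qed.

Lemma as_trans : transitive as_rel.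
Proof.
by move=> v u w /andP[/eqP su /eqP au]; rewrite /as_rel su au.
Qed.

Definition as_equiv := EquivRel as_rel as_refl as_sym as_trans.

Lemma asM (u u' v v' : free_sgrp subset_letter) :
  as_equiv u u' -> as_equiv v v' -> as_equiv (u * v)%g (u' * v')%g.
Proof.
move=> /andP[/eqP su /eqP au] /andP[/eqP sv /eqP av]; apply/andP.
rewrite /word_val /= !size_cat !map_cat !alt_cat !size_map su sv.
by rewrite -!/(word_val _) au av !eqxx.
Qed.

Definition as_cong : congruence (free_sgrp subset_letter) := Congruence asM.

Definition alt_sum_sgrp : semigroupType := quot_sgrp as_cong.

End AlternatingSum.

Arguments alt_sum_sgrp : clear implicits.

(* Main.v *)
(* Along each of the two twists the relations propagate commutation and       *)

(* Both semigroups are quotients of the same free semigroup, so it is enough that the two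
   congruences agree ([kappa_as_cong]). One inclusion is minimality of [kappa] together with
   [as_cong_admissible]. For the other, [sq_const] supplies the central element [d], [on_line_a] and
   [on_line_b] put every arc in the form [a_0 r^k], [rpow_period] gives the relation on [r], and
   [mul_word_normal_form] reduces every word. *)
(* equality of squares, so in the cancellative quotient the squares of all    *)
(* arcs commute with all arcs; since n l is even, walking along the knot      *)
(* identifies them with a single element d. Put t = a_0 a_1. In the group of  *)
(* fractions t / d is a rotation r, the arc of index k is a_0 r^k, and        *)
(* r^(l n + 1) = 1 because the second twist leads back to a_0. As a_0 inverts *)
(* r by conjugation, a word w of length m becomes a_0^m r^f with              *)
(* f = (-1)^(m+1) alt(w), so it is determined by its length and alternating   *)
(* sum. Fractions are avoided by clearing powers of d. Conversely AS is       *)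
(* cancellative and satisfies the crossing relations.                         *)
From HB Require Import structures.
Require Import Defs.
From mathcomp Require Import all_boot all_order all_algebra zify.

Set Implicit Arguments.
Unset Strict Implicit.
Unset Printing Implicit Defensive.

Import GRing.Theory.

(* A semigroup has no zeroth power: [rpow t k p] is [p t^k], with [k = 0]     *)
(* allowed. It is locked because [mulgA] would otherwise see through it.      *)
HB.lock Definition rpow (S : semigroupType) (t : S) (k : nat) (p : S) : S :=
  iter k (fun q => (q * t)%g) p.

(** * Powers in a semigroup without unit *)

Section RightPower.
Local Open Scope group_scope.
Variable S : semigroupType.
Implicit Types p q s t x : S.

Lemma rpow0 t p : rpow t 0 p = p.
Proof. by rewrite unlock. Qed.

Lemma rpowS t k p : rpow t k.+1 p = rpow t k p * t.
Proof. by rewrite unlock. Qed.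

Lemma rpowD t j k p : rpow t (j + k) p = rpow t j (rpow t k p).
Proof. by rewrite unlock; apply: iterD. Qed.

Lemma mulg_rpow t k q p : q * rpow t k p = rpow t k (q * p).
Proof. by elim: k => [|k IHk]; rewrite ?rpow0 // !rpowS -IHk mulgA. Qed.

Lemma rpow_mulg s t k p : commute t s -> rpow t k (p * s) = rpow t k p * s.
Proof.
by move=> ts; elim: k => [|k IHk]; rewrite ?rpow0 // !rpowS IHk -!mulgA ts.
Qed.

Lemma rpowC s t j k p :
  commute s t -> rpow s j (rpow t k p) = rpow t k (rpow s j p).
Proof.
by move=> st; elim: j => [|j IHj]; rewrite ?rpow0 // !rpowS IHj rpow_mulg //.
Qed.

Hypothesis cancS : cancellative S.

Lemma cancel_mulgI x y z : x * y = x * z -> y = z.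
Proof. exact: (proj2 cancS). Qed.

Lemma cancel_mulIg x y z : y * x = z * x -> y = z.
Proof. exact: (proj1 cancS). Qed.

Lemma rpow_inj t k : injective (rpow t k).
Proof.
move=> p q; elim: k => [|k IHk]; first by rewrite !rpow0.
by rewrite !rpowS => /cancel_mulIg.
Qed.

Lemma rpowSr t k p : rpow t k.+1 p = rpow t k (p * t).
Proof. by rewrite -addn1 rpowD rpowS rpow0. Qed.

(** With [r = t / s] the hypothesis reads [r x r = x]: conjugation by [x] inverts [r], so the powers
    of [r] on both sides of [x] cancel. *)
Lemma rpow_conj s t x k p : commute t s -> t * (x * t) = s * (s * x) ->
  commute s x -> rpow t k (rpow t k p * x) = rpow s (k + k) (p * x).
Proof.
move=> ts txt sx; elim: k p => [|k IHk] p; first by rewrite !rpow0.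
rewrite rpowSr rpowS -2!mulgA txt !mulgA -2!(rpow_mulg _ _ ts) IHk.
by rewrite addnS addSn !rpowSr -!mulgA (mulgA x) -sx -mulgA -sx.
Qed.

(** * One twist: a chain of crossings *)

Definition crossing x y z := x * y = y * z /\ y * x = z * y.

Definition chain (u : nat -> S) m :=
  forall i, i < m -> crossing (u i) (u i.+1) (u i.+2).

Lemma crossing_commute s x y z :
  crossing x y z -> commute s x -> commute s y -> commute s z.
Proof.
move=> [xy _] sx sy; apply: (@cancel_mulgI y).
by rewrite mulgA -sy -mulgA -xy mulgA sx -mulgA sy mulgA xy -mulgA.
Qed.

Lemma crossing_sq_commute x y z : crossing x y z -> commute (y * y) x.
Proof. by move=> [xy yx]; rewrite /commute -mulgA yx mulgA -xy mulgA. Qed.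

(** [x x y = y x x = z y x = z z y]; then [y] cancels. *)
Lemma crossing_sq x y z :
  crossing x y z -> commute (x * x) y -> x * x = z * z.
Proof.
move=> [xy yx] xxy; apply: (@cancel_mulIg y).
by rewrite xxy mulgA yx -mulgA yx mulgA.
Qed.

Lemma crossing_sym x y z : crossing x y z -> crossing z y x.
Proof. by case. Qed.

Lemma chain_commute s u m : chain u m -> commute s (u 0) -> commute s (u 1%N) ->
  forall i, i <= m.+1 -> commute s (u i).
Proof.
move=> uc s0 s1 i im; have [] // : commute s (u i) /\
  (i < m.+1 -> commute s (u i.+1)).
elim: i im => // i IHi im; have [si /(_ im) si1] := IHi (ltnW im).
by split=> // im'; apply: crossing_commute si si1; apply: uc.
Qed.

(** The second crossing makes the square of [u 2] commute with [u 1]; the first one then identifies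
    this square with that of [u 0]. *)
Lemma chain_sq_commute u m : chain u m -> (1 < m)%N ->
  commute (u 0 * u 0) (u 1%N) /\ commute (u 1%N * u 1%N) (u 0).
Proof.
move=> uc m1; have c0 := uc 0 (ltnW m1); have c1 := uc 1%N m1.
split; last exact: crossing_sq_commute c0.
have u2 := crossing_sq_commute c1.
by rewrite -(crossing_sq (crossing_sym c0) u2).
Qed.

Lemma chain_sq u m : chain u m ->
  (forall i, i <= m.+1 -> commute (u 0 * u 0) (u i)) ->
  (forall i, i <= m.+1 -> commute (u 1%N * u 1%N) (u i)) ->
  forall i, i <= m.+1 -> u i * u i = u (odd i) * u (odd i).
Proof.
move=> uc u0 u1; elim/ltn_ind=> -[|[|i]] // IH im.
have im1 := ltnW im; have ui := IH i (ltnW (ltnSn _)) (ltnW im1).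
rewrite -(crossing_sq (uc i im)) ui /= ?negbK //.
by case: (odd i); [apply: u1 | apply: u0].
Qed.

Lemma chain_prod u m : chain u m ->
  forall i, i <= m -> u i * u i.+1 = u 0 * u 1%N.
Proof.
by move=> uc; elim=> // i IHi im; case: (uc i im) => <- _; apply/IHi/ltnW.
Qed.

End RightPower.

(** * Two twists joined at their ends *)

Section DoubleChain.
Local Open Scope group_scope.
Variables (S : semigroupType) (cancS : cancellative S).
Variables (n l : nat) (n_gt0 : 0 < n) (l_gt0 : 0 < l).
Hypothesis nl_even : ~~ odd (n * l).
(* [a i] stands for the arc a_i and [b j] for the arc a_(jn+1). *)
Variables a b : nat -> S.
Hypotheses (a_chain : chain a n) (b_chain : chain b l).
Hypotheses (bl : b l = a 0) (b0 : b 0 = a 1%N).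
Hypothesis b1 : b 1%N = a n.+1.

Definition central s := (forall i, i <= n.+1 -> commute s (a i)) /\
  (forall j, j <= l.+1 -> commute s (b j)).

Lemma central_a s : commute s (a 0) -> commute s (a 1%N) -> central s.
Proof.
move=> s0 s1; have sa := chain_commute cancS a_chain s0 s1; split=> //.
by apply: chain_commute => //; rewrite (b0, b1); apply: sa.
Qed.

Lemma central_b s : commute s (b 0) -> commute s (b 1%N) -> central s.
Proof.
move=> s0 s1; have sb := chain_commute cancS b_chain s0 s1.
by apply: central_a; rewrite -?bl -?b0; apply: sb.
Qed.

Definition same_sq (u : nat -> S) m :=
  forall i, i <= m.+1 -> u i * u i = u (odd i) * u (odd i).

Lemma central_same_sq :
  [/\ central (a 0 * a 0), same_sq a n & same_sq b l].
Proof.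
have sq_a : central (a 0 * a 0) -> central (a 1%N * a 1%N) -> same_sq a n.
  by move=> [a0 _] [a1 _]; apply: chain_sq.
have sq_b : central (b 0 * b 0) -> central (b 1%N * b 1%N) -> same_sq b l.
  by move=> [_ ?] [_ ?]; apply: chain_sq.
(* As n l is even, one of the twists has two crossings: start from it. *)
have [n1|n1] := ltnP 1%N n.
  have [a01 a10] := chain_sq_commute cancS a_chain n1.
  have c0 : central (a 0 * a 0).
    by apply: central_a; rewrite // /commute mulgA.
  have c1 : central (a 1%N * a 1%N).
    by apply: central_a; rewrite // /commute mulgA.
  split=> //; first exact: sq_a.
  apply: sq_b; first by rewrite b0.
  by rewrite b1 sq_a //; case: odd.
have En : n = 1%N by apply/eqP; rewrite eqn_leq n1.
have l1 : (1 < l)%N.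
  by move: nl_even; rewrite En mul1n; case: (l) l_gt0 => [|[]].
have [b01 b10] := chain_sq_commute cancS b_chain l1.
have c0 : central (b 0 * b 0).
  by apply: central_b; rewrite // /commute mulgA.
have c1 : central (b 1%N * b 1%N).
  by apply: central_b; rewrite // /commute mulgA.
have sb := sq_b c0 c1.
have ca : central (a 0 * a 0) by rewrite -bl sb //; case: odd.
by split=> //; apply: sq_a => //; rewrite -b0.
Qed.

(** Only [a 0] and [a 1] remain to be compared. The second twist ends at [b l = a 0], whose square
    is that of [b 0 = a 1] for even [l]. For odd [l] it is that of [b 1 = a n.+1], and then [n] is
    even, so [n.+1] has the parity of 1. *)
Lemma sq_const : [/\ central (a 0 * a 0),
  (forall i, i <= n.+1 -> a i * a i = a 0 * a 0) &
  (forall j, j <= l.+1 -> b j * b j = a 0 * a 0)].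
Proof.
have [ca sa sb] := central_same_sq.
have a01 : a 1%N * a 1%N = a 0 * a 0.
  have El := sb _ (leqnSn l); rewrite bl in El.
  have En := sa _ (leqnn n.+1); rewrite -b1 /= in En.
  move: nl_even En El; rewrite oddM negb_and.
  case: (odd l) => /=; rewrite ?b0 => on.
    by rewrite (negbTE (_ : ~~ odd n)) //=; [move=> <- <- | case/orP: on].
  by move=> _ ->.
have sa' i : i <= n.+1 -> a i * a i = a 0 * a 0.
  by move/sa->; case: odd.
split=> // j /sb->; case: odd => /=; rewrite (b0, b1) //.
exact: sa'.
Qed.

Local Notation d := (a 0 * a 0).
Local Notation t := (a 0 * a 1%N).

(* In the group of fractions this says that [x] is [a 0 * (t / d) ^+ k].      *)
Definition on_line k x := forall p, rpow t k (p * a 0) = rpow d k p * x.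

Lemma sq_commute : [/\ forall i, i <= n.+1 -> commute d (a i),
  forall j, j <= l.+1 -> commute d (b j) & commute d t].
Proof.
have [[da db] _ _] := sq_const; split=> //.
by apply: commuteM; apply: da.
Qed.

Lemma on_line_a i : i <= n.+1 -> on_line i (a i).
Proof.
have [_ sa _] := sq_const; have [da _ _] := sq_commute.
case: i => [|i] im p; first by rewrite !rpow0.
elim: i im => [|i IHi] im.
  by rewrite !rpowS !rpow0 !mulgA.
rewrite rpowS (IHi (ltnW im)) -(chain_prod a_chain (i := i.+1) im) -!mulgA.
by rewrite (mulgA (a _)) sa 1?ltnW // !rpowS !mulgA.
Qed.

(** One step of the second twist is [n] steps of the rotation, because
    [b j * b j.+1 = b 0 * b 1 = a 1 * a n.+1] is [t^n / d^(n-1)]. *)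
Lemma on_line_b j : j <= l.+1 -> on_line (j * n + 1)%N (b j).
Proof.
have [da db dt] := sq_commute; have [ca sa sb] := sq_const.
have tn p : rpow t n p = rpow d n.-1 p * (b 0 * b 1%N).
  rewrite b0 b1; case: (n) n_gt0 a_chain da sa => // m _ ac da' sa'.
  suff ti i : i <= m -> rpow t i.+1 p = rpow d i p * (a 1%N * a i.+2).
    exact: ti.
  elim: i => [|i IHi] im; first by rewrite rpowS !rpow0 (chain_prod ac).
  rewrite rpowS (IHi (ltnW im)) -(chain_prod ac (i := i.+2)) //.
  rewrite -!mulgA (mulgA (a i.+2)) sa' 1?ltnW // (mulgA (a 1%N)) -da' //.
  by rewrite !rpowS !mulgA.
elim: j => [|j IHj] jl p; first by rewrite b0; apply: on_line_a.
rewrite mulSn -addnA rpowD (IHj (ltnW jl)) tn rpow_mulg; last exact/db/ltnW.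
rewrite -(chain_prod b_chain jl) -mulgA (mulgA (b j)) sb; last exact: ltnW.
have dn q : rpow d n q = rpow d n.-1 q * d by rewrite -rpowS prednK.
by rewrite (rpowD d n) dn !mulgA.
Qed.

(** [b l] has index [l n + 1] and equals [a 0], of index 0. *)
Lemma rpow_period p : rpow t (l * n).+1 p = rpow d (l * n).+1 p.
Proof.
have [da _ _] := sq_commute.
have E : rpow t (l * n).+1 (a 0 * a 0) = rpow d (l * n).+1 (a 0 * a 0).
  have := on_line_b (leqnSn l) (a 0); rewrite addn1 bl => ->.
  by rewrite rpow_mulg //; apply: da.
(* Peeling off one factor leaves a genuine element [rpow t (l * n) t], so the prefix [a 0 * a 0] can
   be cancelled and replaced by [p]. *)
by move: E; rewrite !rpowSr -!mulg_rpow => /(cancel_mulgI cancS) ->.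
Qed.

Lemma rpow_period_mul j p :
  rpow t (j * (l * n).+1) p = rpow d (j * (l * n).+1) p.
Proof.
elim: j p => [|j IHj] p; first by rewrite !rpow0.
by rewrite mulSn !rpowD IHj rpow_period.
Qed.

Lemma on_line_mod k k' x : commute d x ->
  k = k' %[mod (l * n).+1] -> on_line k x -> on_line k' x.
Proof.
have [_ _ dt] := sq_commute; set N := (l * n).+1 => dx kk' kx p.
have tdN j q := rpow_period_mul j q.
have kr q : rpow t (k %% N) (q * a 0) = rpow d (k %% N) q * x.
  apply: (rpow_inj cancS (t := d) (k := k %/ N * N)).
  by rewrite [RHS]rpow_mulg // -tdN -!rpowD -divn_eq kx.
rewrite (divn_eq k' N) !rpowD tdN -kk' kr -rpow_mulg //.
by rewrite rpow_mulg // !rpow_mulg.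
Qed.

(** * Normal form of words *)

Section Words.
Local Open Scope ring_scope.
Variables (A : Type) (arc : A -> S) (idx : A -> 'I_(l * n).+1).
Hypothesis arc_line : forall x, exists k, [/\ inZp k = idx x,
  on_line k (arc x) & commute d (arc x)].

Definition mul_word p w : S := foldl (fun q x => (q * arc x)%g) p w.

Lemma inZpD j k : inZp (j + k) = inZp j + inZp k :> 'I_(l * n).+1.
Proof. by apply: val_inj; rewrite /= modnDm. Qed.

Lemma rpow_conj_t k p :
  rpow t k (rpow t k p * a 0)%g = rpow d (k + k) (p * a 0)%g.
Proof.
have [da _ dt] := sq_commute; have [_ sa _] := sq_const.
have tat : (t * (a 0 * t) = d * (d * a 0))%g.
  rewrite (mulgA (a 0) (a 0)) mulgA -dt -[LHS]mulgA; congr (d * _)%g.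
  by rewrite -mulgA sa // da.
by apply: rpow_conj => //; apply: da.
Qed.

(** The sign makes the last letter count positively. Appending [a_0 r^k] to [a_0^m r^e] gives
    [a_0^(m+1) r^(k-e)], since [a_0] inverts [r]; the signed sum obeys the same recursion. *)
Lemma mul_word_normal_form w f p :
  inZp f = alt (map idx w) *~ (-1) ^+ (size w).+1 ->
  rpow d f (mul_word p w) = rpow t f (rpow (a 0) (size w) p).
Proof.
have [da _ dt] := sq_commute.
elim/last_ind: w f p => [|w x IHw] f p.
  rewrite /alt big_ord0 mul0rz /= => /(congr1 val) /= f0.
  by rewrite (divn_eq f (l * n).+1) f0 addn0 rpow0 rpow_period_mul.
rewrite size_rcons map_rcons -cats1 alt_cat size_map mulrzDl -mulrzA -exprD.
rewrite {2}/alt big_ord1 /= !addnS.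
rewrite -(signr_odd _ (_ + _).+2) /= negbK oddD addbb /= !mulr1z => fE.
have [k [kx lk dx]] := arc_line x.
set e := val (alt (map idx w) *~ (-1) ^+ (size w).+1).
have eE : inZp e = alt (map idx w) *~ (-1) ^+ (size w).+1 by rewrite valZpK.
have feE : inZp (f + e) = idx x.
  by rewrite inZpD eE fE exprS mulN1r mulrNz addrAC addNr add0r.
have lfe : on_line (f + e) (arc x).
  by apply: on_line_mod lk => //; have /(congr1 val) := etrans kx (esym feE).
rewrite /mul_word foldl_rcons -/(mul_word p w).
(* Moving [t^e] past [a 0] costs [d^(e+e)], so both sides are first multiplied by it. *)
apply: (rpow_inj cancS (t := d) (k := e + e)).
rewrite -rpowD addnC addnA rpowD (rpow_mulg e _ dx) (IHw _ _ eE).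
rewrite (rpow_mulg _ _ dx) -lfe rpowD rpow_conj_t -rpowS rpowC //.
Qed.

Lemma mul_word_eq p u v :
  size u = size v -> alt (map idx u) = alt (map idx v) ->
  mul_word p u = mul_word p v.
Proof.
move=> suv auv; set s := alt (map idx u) *~ (-1) ^+ (size u).+1.
have [f fu] : exists f, inZp f = s by exists (val s); rewrite valZpK.
apply: (rpow_inj cancS (t := d) (k := f)).
by rewrite !mul_word_normal_form // -?auv -?suv.
Qed.

End Words.
End DoubleChain.

(** * Quotients of free semigroups *)

Section Quotients.
Local Open Scope quotient_scope.

Lemma iso_quot_sgrp (S : semigroupType) (c c' : congruence S) :
  c =2 c' -> sgrp_isomorphic (quot_sgrp c) (quot_sgrp c').
Proof.
move=> cc'.
pose f (p : quot_sgrp c) : quot_sgrp c' := \pi_(quot_sgrp c') (repr p).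
pose g (p : quot_sgrp c') : quot_sgrp c := \pi_(quot_sgrp c) (repr p).
have f_pi x : f (\pi_(quot_sgrp c) x) = \pi_(quot_sgrp c') x.
  by apply/eqmodP; rewrite -cc'; apply/eqmodP; rewrite reprK.
have g_pi x : g (\pi_(quot_sgrp c') x) = \pi_(quot_sgrp c) x.
  by apply/eqmodP; rewrite cc'; apply/eqmodP; rewrite reprK.
have fM (p q : quot_sgrp c) : f (p * q)%g = (f p * f q)%g.
  by elim/quotW: p => x; elim/quotW: q => y; rewrite pi_mulg !f_pi pi_mulg.
pose F := isMultiplicative.Build _ _ f fM.
pose F' : {multiplicative quot_sgrp c -> quot_sgrp c'} := HB.pack f F.
have fK : cancel f g by move=> p; elim/quotW: p => x; rewrite f_pi g_pi.
have gK : cancel g f by move=> p; elim/quotW: p => x; rewrite g_pi f_pi.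
by exists F'; exists g.
Qed.

Lemma pi_word (A : choiceType) (c : congruence (free_sgrp A)) p
    (u : free_sgrp A) :
  (p * \pi_(quot_sgrp c) u)%g =
  mul_word (fun x => \pi_(quot_sgrp c) (letter x)) p (val u).
Proof.
case: u => w; elim: w p => //= x [_ p nw|y w IHw p nw].
  by rewrite /mul_word /=; congr (_ * \pi_(quot_sgrp c) _)%g; apply: val_inj.
have -> : exist _ (x :: y :: w) nw =
  (letter x * exist _ (y :: w) isT)%g :> free_sgrp A by exact: val_inj.
by rewrite -pi_mulg mulgA IHw.
Qed.

End Quotients.

Section AltSum.
Local Open Scope ring_scope.
Local Open Scope quotient_scope.
Variables (G : zmodType) (B : {pred G}).

Lemma alt_mulg (u v : free_sgrp (subset_letter B)) :
  alt (word_val (u * v)%g) =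
  alt (word_val u) + alt (word_val v) *~ (-1) ^+ size (val u).
Proof. by rewrite /word_val /= map_cat alt_cat size_map. Qed.

Lemma as_cong_cancellative : cancellative (quot_sgrp (as_cong B)).
Proof.
split=> p q r; elim/quotW: p => u; elim/quotW: q => v; elim/quotW: r => w;
  rewrite !pi_mulg => /eqmodP/andP[]; rewrite !alt_mulg /= !size_cat.
  rewrite eqn_add2r => /eqP suv; rewrite suv => /eqP/addIr auv.
  by apply/eqmodP; rewrite /= /as_rel suv auv !eqxx.
rewrite eqn_add2l => /eqP svw /eqP/addrI avw.
apply/eqmodP; rewrite /= /as_rel svw eqxx /=; apply/eqP.
have /(congr1 (fun x => x *~ (-1) ^+ size (val u))) := avw.
by rewrite -!mulrzA -!exprD addnn -signr_odd odd_double !mulr1z.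
Qed.

End AltSum.

(** * The double twist diagram *)

Section DoubleTwist.
Variables (n l : nat) (n_gt0 : 0 < n) (l_gt0 : 0 < l).
Hypothesis nl_even : ~~ odd (n * l).
Local Open Scope quotient_scope.

Local Notation K := (dtw n l).

(** The term [j = 0] only adds the index 1, already present as [n] is positive. *)
Lemma dtw_index_full : [set inZp (val i) | i : 'I_n.+1] :|:
  [set inZp (val j * n + 1) | j : 'I_l] = dtw_index n l.
Proof.
apply/setP => x; rewrite !inE; apply/idP/idP.
  case/orP => [->//|/imsetP[j _ ->]].
  have [j0|j0] := posnP j; last first.
    by apply/orP; right; apply/imsetP; exists j; rewrite ?inE.
  rewrite /= j0 mul0n add0n; apply/orP; left; apply/imsetP.
  by exists (Ordinal (n_gt0 : 1 < n.+1)).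
case/orP => [->//|/imsetP[j _ ->]].
by apply/orP; right; apply/imsetP; exists j.
Qed.

Lemma dtw_crossing_a i : i < n ->
  (dtw_a n l i, dtw_a n l i.+1, dtw_a n l i.+2) \in crossings K.
Proof.
move=> i_n; rewrite mem_cat; apply/orP; left.
by apply/mapP; exists i.+1; rewrite // mem_iota.
Qed.

Lemma dtw_crossing_b j : j < l ->
  (dtw_a n l (j * n + 1), dtw_a n l (j.+1 * n + 1), dtw_a n l (j.+2 * n + 1))
    \in crossings K.
Proof.
(* The diagram lists these crossings in decreasing index, hence the reversal. *)
move=> jl; rewrite mem_cat; apply/orP; right; apply/mapP; exists (l - j.+1).
  by rewrite mem_iota add0n ltn_subrL l_gt0.
by rewrite subKn // subn1 (addn1 j.+1).
Qed.

Lemma dtw_a_eq i j :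
  i %% (l * n).+1 = j %% (l * n).+1 -> dtw_a n l i = dtw_a n l j.
Proof. by move=> ij; congr insubd; apply: val_inj. Qed.

Lemma dtw_arcP (x : dtw_arc n l) :
  (exists2 i, i <= n & x = dtw_a n l i) \/
  (exists2 j, j <= l & x = dtw_a n l (j * n + 1)).
Proof.
have := valP x; rewrite inE => /orP[]/imsetP[i _ xi]; [left|right]; exists i.
- by rewrite -ltnS.
- by apply: val_inj; rewrite val_dtw_a // ltnW.
- exact: ltnW.
- by apply: val_inj; rewrite val_dtw_a_mul; last exact/ltnW/ltnW/ltn_ord.
Qed.

(** The overcrossing index is the midpoint of the other two modulo [l n + 1]; this is what makes
    both sides of a crossing relation have equal alternating sums. *)
Lemma dtw_crossing_midpoint x y z : (x, y, z) \in crossings K ->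
  (val x + val z = val y + val y)%R.
Proof.
have mid i j k : i + k = j + j ->
    (inZp i + inZp k = inZp j + inZp j :> 'I_(l * n).+1)%R.
  by rewrite -!inZpD => ->.
rewrite mem_cat => /orP[] /mapP[i]; rewrite mem_iota => /andP[i1 i2] [-> -> ->].
  rewrite !val_dtw_a; try by lia.
  apply: mid; lia.
rewrite !val_dtw_a_mul; try by lia.
apply: mid; nia.
Qed.

Lemma as_cong_admissible : @admissible K (as_cong (mem (dtw_index n l))).
Proof.
split=> [x y z /dtw_crossing_midpoint xzy|]; last exact: as_cong_cancellative.
split; apply/andP; split=> //; apply/eqP;
  rewrite /word_val /alt /= !big_ord_recl !big_ord0 /= !addr0 !mulr1z !mulrN1z.
  by rewrite -[in LHS](addrK (val z) (val x)) xzy addrAC addrK.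
by rewrite -[in RHS](addrK (val x) (val z)) (addrC (val z)) xzy addrAC addrK.
Qed.

Lemma kappa_as_cong : kappa K =2 as_cong (mem (dtw_index n l)).
Proof.
move=> u v; apply/idP/idP; first exact: (kappa_min as_cong_admissible).
move=> /andP[/eqP suv /eqP auv].
have [rK cK] := kappa_admissible K.
set M := quot_sgrp (kappa K).
pose arc (x : dtw_arc n l) : M := \pi_M (letter x).
have arcC x y z : (x, y, z) \in crossings K -> crossing (arc x) (arc y) (arc z).
  move=> /rK[xy yx]; rewrite /crossing /arc !pi_mulg.
  by split; apply/eqmodP.
pose a i := arc (dtw_a n l i); pose b j := arc (dtw_a n l (j * n + 1)).
have a_chain : chain a n by move=> i /dtw_crossing_a/arcC.
have b_chain : chain b l by move=> j /dtw_crossing_b/arcC.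
have bl : b l = a 0 by congr arc; apply: dtw_a_eq; rewrite addn1 modnn mod0n.
have b0 : b 0 = a 1 by [].
have b1 : b 1 = a n.+1 by rewrite /b mul1n addn1.
have line x : exists k, [/\ inZp k = val x, on_line a k (arc x) &
    commute (a 0 * a 0)%g (arc x)].
  have [da db _] := sq_commute cK n_gt0 l_gt0 nl_even a_chain b_chain bl b0 b1.
  have [[i i_n ->]|[j j_l ->]] := dtw_arcP x.
    exists i; split; [by rewrite val_dtw_a // ltnW | | exact/da/ltnW].
    apply: (on_line_a cK n_gt0 l_gt0 nl_even a_chain b_chain) => //.
    exact: ltnW.
  exists (j * n + 1).
  split; [by rewrite val_dtw_a_mul // ltnW | | exact/db/ltnW].
  apply: (on_line_b cK n_gt0 l_gt0 nl_even a_chain b_chain) => //.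
  exact: ltnW.
suff : \pi_M u = \pi_M v by move/eqmodP.
(* A prefix [a 0], cancelled afterwards, gives [mul_word] its starting value. *)
apply: (proj2 cK (a 0)); rewrite !pi_word.
exact: (mul_word_eq cK n_gt0 l_gt0 nl_even a_chain b_chain bl b0 b1 line).
Qed.

End DoubleTwist.

Theorem theorem4p2 (n l : nat) (n_ge1 : 1 <= n) (l_ge1 : 1 <= l)
    (nl_even : ~~ odd (n * l)) :
  sgrp_isomorphic (knot_sgrp (dtw n l))
    (alt_sum_sgrp 'I_(l * n).+1
       ([set inZp (val i) | i : 'I_n.+1] :|:
        [set inZp (val j * n + 1) | j : 'I_l])).
Proof.
rewrite dtw_index_full //.
exact: iso_quot_sgrp (kappa_as_cong n_ge1 l_ge1 nl_even).
Qed.
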